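(* For every integer $n\ge 1$, the total number $r(n)$ of $(-1)$-Dyck paths of semi-length $n$ is given by $$r(n)=\sum_{\ell=0}^n\sum_{i=0}^{n-\ell-1}\binom{n-\ell-1}{i}q^{(i)}(\ell),$$ where $$q^{(i)}(n)=\sum_{n_1+n_2+\cdots+n_i=n}b(n_1)b(n_2)\cdots b(n_i),$$ the sum running over all $i$-tuples $(n_1,\dots,n_i)$ of nonnegative integers with sum $n$.
   Context: A Dyck path is a lattice path in the first quadrant that starts at the origin, ends on the $x$-axis, and consists of steps $U=(1,1)$ and $D=(1,-1)$ (never going below the $x$-axis). Its semi-length is its number of $U$ steps. A valley is an occurrence of two consecutive steps $DU$; the level of a valley is the $y$-coordinate of its lowest point. Let $\nu=(\nu_1,\dots,\nu_k)$ be the levels of all valleys of $P$, listed from left to right. A Dyck path is called $(-1)$-Dyck if it has at most one valley or if $\nu_{i+1}-\nu_i\ge -1$ for all $1\le i<k$. For $n\ge 0$, $b(n)$ is the number of $(-1)$-Dyck paths of semi-length $n$ that either have no valleys or whose last (rightmost) valley is at ground level (level $0$); the empty path is counted, so $b(0)=1$. By the empty-product convention, $q^{(0)}(0)=1$ and $q^{(0)}(n)=0$ for $n\ge 1$. Inner sums with upper limit $-1$ are empty. *)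

(* Defs.v *)
From mathcomp Require Import all_boot all_order all_algebra.

Set Implicit Arguments.
Unset Strict Implicit.
Unset Printing Implicit Defensive.

(* A lattice path is its sequence of steps: [true] is U = (1,1) and [false]
   is D = (1,-1). *)
Notation U := true (only parsing).
Notation D := false (only parsing).

Definition semilength (p : seq bool) : nat := count_mem U p.

(* y-coordinate reached after the first [i] steps *)
Definition height (p : seq bool) (i : nat) : int :=
  ((count_mem U (take i p))%:Z - (count_mem D (take i p))%:Z)%R.

Definition is_dyck (p : seq bool) : bool :=
  all (fun i => (0 <= height p i)%R) (iota 0 (size p).+1)
  && (height p (size p) == 0%R).

(* Steps number [i] and [i.+1] (counted from 0) form a valley; its lowest
   point is reached after [i.+1] steps. *)
Definition is_valley (p : seq bool) (i : nat) : bool :=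
  [&& i.+1 < size p, nth U p i == D & nth D p i.+1 == U].

Definition valley_levels (p : seq bool) : seq int :=
  [seq height p i.+1 | i <- iota 0 (size p) & is_valley p i].

Definition is_m1_dyck (p : seq bool) : bool :=
  is_dyck p &&
  ((size (valley_levels p) <= 1)
   || sorted (fun x y : int => (-1 <= y - x)%R) (valley_levels p)).

(* The default value of [last] is irrelevant: it is used only on a nonempty
   sequence. *)
Definition no_or_ground_last_valley (p : seq bool) : bool :=
  (valley_levels p == [::]) || (last 0%R (valley_levels p) == 0%R).

(* Justifies counting the paths of semi-length n among the sequences of 2n
   steps. *)
Lemma size_dyck (p : seq bool) : is_dyck p -> size p = 2 * semilength p.
Proof.
case/andP=> _; rewrite /height take_size GRing.subr_eq0 => /eqP[eqUD].
rewrite /semilength mul2n -addnn {2}eqUD -(count_predC (pred1 U) p).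
by congr (_ + _); apply: eq_count => -[].
Qed.

Definition r (n : nat) : nat :=
  #|[set p : (2 * n).-tuple bool | is_m1_dyck p & semilength p == n]|.

Definition b (n : nat) : nat :=
  #|[set p : (2 * n).-tuple bool |
     [&& is_m1_dyck p, semilength p == n & no_or_ground_last_valley p]]|.

(* Nonnegative integers with sum [n] are at most [n], so the [i]-tuples can be
   taken in ['I_n.+1]. *)
Definition q (i n : nat) : nat :=
  \sum_(t : {ffun 'I_i -> 'I_n.+1} | \sum_(j < i) t j == n)
     \prod_(j < i) b (t j).

(* Main.v *)
Require Import Defs.
From mathcomp Require Import all_boot all_order all_algebra zify.
Import Order.TTheory GRing.Theory Num.Theory.

(** Write R, S = R - 1 and B for the generating functions of [r], of [r]
restricted to nonempty paths, and of [b].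

A nonempty Dyck path is uniquely an arch U A D followed by a Dyck path B'.
Its valleys are those of A, raised by 1, and then, when B' is nonempty, a
valley at level 0 followed by the valleys of B'.  Nothing that follows a
valley at level 0 can break the condition on consecutive levels, so the path
is (-1)-Dyck exactly when A is, and, if B' is nonempty, when moreover B' is
(-1)-Dyck and the last valley of A, raised by 1, is at level at most 1, which
means that A is one of the paths counted by [b].  Hence
  S = x R + x B S = x + x (1 + B) S,
which is [r_rec] (the combinatorial core is [m1_dyck_arch] together with the
uniqueness of the decomposition, [arch_inj]).

Solving, S is the sum over m of x^(m+1) (1 + B)^m.  Since [q i l] is the
coefficient of x^l in B^i ([qE]), expanding (1 + B)^m by the binomial theorem
yields the stated double sum.  Formally, that double sum is shown to satisfy
the same recurrence as [r] ([T_rec]), by way of Pascal's rule ([c_rec]). *)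

(** * Heights and the first-return decomposition *)

(** The path that raises [A] into an arch and continues with [B]. *)
Definition arch (A B : seq bool) : seq bool := U :: A ++ D :: B.

Lemma height0 p : height p 0 = 0%R.
Proof. by rewrite /height take0. Qed.

Lemma height_cons x p i :
  height (x :: p) i.+1 = ((if x then 1 else -1) + height p i)%R.
Proof. by rewrite /height /=; case: x => /=; lia. Qed.

Lemma height_catl p s i : i <= size p -> height (p ++ s) i = height p i.
Proof. by rewrite /height => le_ip; rewrite takel_cat. Qed.

Lemma height_catr p s i :
  height (p ++ s) (size p + i) = (height p (size p) + height s i)%R.
Proof.
elim: p => [|x p IHp]; first by rewrite height0 add0r add0n.
by rewrite /= addSn !height_cons IHp addrA.
Qed.

Lemma is_dyckP p :
  reflect ((forall i, i <= size p -> (0 <= height p i)%R)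
           /\ height p (size p) = 0%R)
          (is_dyck p).
Proof.
apply: (iffP andP) => [[/allP ge0 /eqP end0]|[ge0 end0]]; split=> //.
- by move=> i le_ip; apply: ge0; rewrite mem_iota.
- by apply/allP=> i; rewrite mem_iota => /andP[_ lt_ip]; apply: ge0.
- by rewrite end0.
Qed.

Lemma dyck_arch A B : is_dyck A -> is_dyck B -> is_dyck (arch A B).
Proof.
move=> /is_dyckP[geA endA] /is_dyckP[geB endB].
have hB i : height (arch A B) (size A + i.+1).+1 = height B i.
  by rewrite height_cons height_catr endA height_cons; lia.
apply/is_dyckP; split; last by rewrite /= size_cat /= hB.
case=> [|i]; first by rewrite height0.
rewrite /= size_cat /= ltnS => le_i; have [le_iA|lt_Ai] := leqP i (size A).
  by rewrite height_cons height_catl //; have := geA i le_iA; lia.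
by rewrite -(subnKC lt_Ai) addSnnS hB; apply: geB; lia.
Qed.

(** The first step below ground level follows a Dyck prefix. *)
Lemma first_descent w :
    (height w (size w) < 0)%R ->
  exists A B, w = A ++ D :: B /\ is_dyck A.
Proof.
move=> neg_w; have exn : exists i, (height w i < 0)%R by exists (size w).
(* Cut just before the first point [i.+1] below ground level. *)
have [[|i] neg_i min_i] := find_ex_minn exn; first by rewrite height0 in neg_i.
have ge_i j : j <= i -> (0 <= height w j)%R.
  by move=> le_ji; rewrite leNgt; apply/negP=> /min_i; rewrite ltnNge le_ji.
have lt_iw : i < size w.
  rewrite ltnNge; apply/negP=> le_wi; have := ge_i i (leqnn i).
  by move: neg_i; rewrite /height !take_oversize //; lia.
have sA : size (take i w) = i by rewrite size_takel // ltnW.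
have def_w : w = take i w ++ nth U w i :: drop i.+1 w.
  by rewrite -drop_nth // cat_take_drop.
have hA j : j <= i -> height (take i w) j = height w j.
  by move=> le_ji; rewrite [in RHS]def_w height_catl // sA.
have := height_catr (take i w) (nth U w i :: drop i.+1 w) 1.
rewrite -def_w height_cons height0 sA hA // addn1 => eq_i.
rewrite {}eq_i in neg_i; have ge0_i := ge_i i (leqnn i).
exists (take i w), (drop i.+1 w); split.
  by rewrite {1}def_w; case: (nth U w i) neg_i => //; lia.
apply/is_dyckP; rewrite sA; split=> [j le_ji|]; rewrite hA ?ge_i //.
by case: (nth U w i) neg_i; lia.
Qed.

Lemma dyck_arch_exists p : is_dyck p -> p != [::] ->
  exists A B, [/\ p = arch A B, is_dyck A & is_dyck B].
Proof.
case: p => [|x w] //= /is_dyckP[ge0 end0] _.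
have x_up : x = U.
  have := ge0 1; rewrite height_cons height0 /=.
  by case: x {ge0 end0} => // /(_ isT).
subst x; have [|A [B [def_w dA]]] := @first_descent w.
  by move: end0; rewrite /= height_cons; lia.
exists A, B; split=> //; first by rewrite /arch -def_w.
have [geA endA] := is_dyckP _ dA.
have hB i : height (U :: w) (size A + i.+1).+1 = height B i.
  by rewrite height_cons def_w height_catr endA height_cons; lia.
apply/is_dyckP; split=> [i le_iB|].
  by rewrite -hB; apply: ge0; rewrite def_w /= size_cat /=; lia.
by rewrite -hB -end0 /= def_w size_cat.
Qed.

(** If [A] were shorter than [A'], the down step after [A] would take [A']
below ground level. *)
Lemma dyck_prefix_le A A' B B' :
  is_dyck A -> is_dyck A' -> A ++ D :: B = A' ++ D :: B' -> size A' <= size A.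
Proof.
move=> /is_dyckP[_ endA] /is_dyckP[geA' _] eqw; rewrite leqNgt; apply/negP=> ltA.
have := geA' (size A + 1); rewrite addn1 => /(_ ltA).
rewrite -(height_catl A' (D :: B')) // -eqw -addn1 height_catr endA.
by rewrite height_cons height0.
Qed.

(** The first-return decomposition is unique. *)
Lemma arch_inj A A' B B' : is_dyck A -> is_dyck A' ->
  arch A B = arch A' B' -> A = A' /\ B = B'.
Proof.
move=> dA dA' [eqw].
have eqs : size A = size A'.
  by apply/eqP; rewrite eqn_leq (dyck_prefix_le _ _ _ _ dA dA' eqw)
    (dyck_prefix_le _ _ _ _ dA' dA (esym eqw)).
by move/eqP: eqw; rewrite eqseq_cat // eqseq_cons => /and3P[/eqP-> _ /eqP->].
Qed.

Lemma semilength_arch A B :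
  semilength (arch A B) = (semilength A + semilength B).+1.
Proof. by rewrite /semilength /= count_cat. Qed.

(** * Valleys of an arch followed by a path *)

Lemma valley_levels_cons x p : valley_levels (x :: p) =
  (if (x == D) && (head D p == U) then [:: -1 : int]%R else [::]) ++
  [seq ((if x then 1 else -1) + h)%R | h <- valley_levels p].
Proof.
rewrite /valley_levels /= (iotaDl 1 0) filter_map.
have -> : is_valley (x :: p) 0 = (x == D) && (head D p == U).
  by rewrite /is_valley /= -nth0; case: p => [|y p] //=; rewrite andbF.
set s := map (addn 1) _; have <- : [seq height (x :: p) i.+1 | i <- s]
  = [seq ((if x then 1 else -1) + h)%R
       | h <- [seq height p i.+1 | i <- iota 0 (size p) & is_valley p i]].
  rewrite {}/s -!map_comp; under eq_map => i do rewrite /= add1n height_cons.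
  by congr map; apply: eq_filter.
by case: ifP => //= /andP[/eqP-> _]; rewrite height_cons height0.
Qed.

(** The defaults [U] of [last] and [D] of [head] make the middle term, the
valley created by the concatenation, vanish when [p] or [s] is empty. *)
Lemma valley_levels_cat p s : valley_levels (p ++ s) =
  valley_levels p ++
  (if (last U p == D) && (head D s == U) then [:: height p (size p)] else [::]) ++
  [seq (height p (size p) + h)%R | h <- valley_levels s].
Proof.
elim: p => [|x p IHp].
  by rewrite /= height0; under eq_map => h do rewrite add0r; rewrite map_id.
rewrite cat_cons !valley_levels_cons IHp !map_cat /= height_cons -catA.
rewrite [X in _ ++ _ ++ _ ++ X](_ : _ =
  [seq ((if x then 1 else -1) + height p (size p) + h)%R | h <- valley_levels s]);
  last by rewrite -map_comp; apply: eq_map => h /=; rewrite addrA.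
case: p {IHp} => [|y p] /=.
  by rewrite height0 addr0; case: x; case: s => [|[] s].
by congr (_ ++ (_ ++ _)); case: (_ && _).
Qed.

Lemma dyck_head B : is_dyck B -> head D B = (B != [::]).
Proof.
case: B => [|x B] //= /is_dyckP[/(_ 1 isT)].
by rewrite height_cons height0; case: x.
Qed.

Lemma valley_levels_ge0 p h : is_dyck p -> h \in valley_levels p -> (0 <= h)%R.
Proof.
move=> /is_dyckP[ge0 _] /mapP[i + ->]; rewrite mem_filter mem_iota => /andP[_].
by move=> /andP[_]; apply: ge0.
Qed.

Lemma valley_levels_arch A B : is_dyck A -> is_dyck B ->
  valley_levels (arch A B) =
  [seq (1 + h)%R | h <- valley_levels A] ++
  (if B == [::] then [::] else 0%R :: valley_levels B).
Proof.
move=> dA dB; have [_ endA] := is_dyckP _ dA.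
rewrite /arch -cat_rcons -cat_cons valley_levels_cat -cats1.
have -> : height (U :: A ++ [:: D]) (size (U :: A ++ [:: D])) = 0%R.
  by rewrite /= size_cat height_cons height_catr endA height_cons height0.
rewrite valley_levels_cons /= valley_levels_cat last_cat (dyck_head B dB) /=.
rewrite andbF !cats0 eqb_id.
have -> : [seq (0 + h)%R | h <- valley_levels B] = valley_levels B.
  by under eq_map => h do rewrite add0r; rewrite map_id.
by case: (B).
Qed.

(** The relation required between the levels of two consecutive valleys. *)
Definition m1_rel (x y : int) : bool := (-1 <= y - x)%R.

(** A sequence of at most one level is sorted, so the case of at most one
valley needs no separate treatment. *)
Lemma is_m1_dyckE p : is_m1_dyck p = is_dyck p && sorted m1_rel (valley_levels p).
Proof.
rewrite /is_m1_dyck; case: (is_dyck p) => //=.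
by case: (valley_levels p) => [|x [|y s]].
Qed.

Lemma m1_dyck_dyck p : is_m1_dyck p -> is_dyck p.
Proof. by case/andP. Qed.

(** The last valley of [A], raised by 1, precedes the valley at level 0 between
[A] and a nonempty [B]; as levels are nonnegative, the condition there is that
[A] has no valley or that its last one is at ground level. *)
Lemma m1_dyck_arch A B : is_dyck A -> is_dyck B ->
  is_m1_dyck (arch A B) =
  is_m1_dyck A &&
  ((B == [::]) || (no_or_ground_last_valley A && is_m1_dyck B)).
Proof.
move=> dA dB; rewrite !is_m1_dyckE dA dB dyck_arch // valley_levels_arch //=.
have shiftE s : sorted m1_rel [seq (1 + h)%R | h <- s] = sorted m1_rel s.
  by rewrite sorted_map; apply: eq_sorted => x y; rewrite /m1_rel /=; lia.
case: eqP => [_|_] /=; first by rewrite cats0 shiftE andbT.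
(* Levels are nonnegative, so anything may follow a valley at level 0. *)
rewrite sorted_cat_cons; have -> :
    path m1_rel 0 (valley_levels B) = sorted m1_rel (valley_levels B).
  case: (valley_levels B) (valley_levels_ge0 B ^~ dB) => [|h s] //= ge0.
  by rewrite (_ : m1_rel _ _) // /m1_rel; have := ge0 h (mem_head _ _); lia.
rewrite andbA; congr (_ && _); rewrite /no_or_ground_last_valley -[in RHS]shiftE.
have ge0 := valley_levels_ge0 A ^~ dA.
case: (valley_levels A) ge0 => [|h s] //= ge0.
rewrite rcons_path; congr (_ && _).
rewrite (last_map (fun h : int => (1 + h)%R)) /m1_rel.
have := ge0 _ (mem_last h s); move: (last h s) => z ge0z.
by apply/idP/eqP; lia.
Qed.

(** * Counting by lists of paths *)

(** All sequences of [2 * n] steps, without repetition. *)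
Definition words (n : nat) : seq (seq bool) :=
  map val (enum {: (2 * n).-tuple bool}).

Lemma uniq_words n : uniq (words n).
Proof. by rewrite map_inj_uniq ?enum_uniq //; apply: val_inj. Qed.

Lemma mem_words n p : (p \in words n) = (size p == 2 * n).
Proof.
apply/mapP/eqP => [[t _ ->]|sp]; first by rewrite size_tuple.
by exists (Tuple (introT eqP sp)); rewrite ?mem_enum.
Qed.

Lemma card_words n (P : pred (seq bool)) :
  #|[set t : (2 * n).-tuple bool | P t]| = size [seq p <- words n | P p].
Proof.
rewrite cardsE cardE size_filter /words count_map.
by rewrite -size_filter enumT.
Qed.

(** The (-1)-Dyck paths of semi-length [n], without repetition. *)
Definition m1_paths (n : nat) : seq (seq bool) :=
  [seq p <- words n | is_m1_dyck p & semilength p == n].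

(** Those among them that are counted by [b n]. *)
Definition m1_ground_paths (n : nat) : seq (seq bool) :=
  [seq p <- m1_paths n | no_or_ground_last_valley p].

Lemma mem_m1_paths n p : (p \in m1_paths n) = is_m1_dyck p && (semilength p == n).
Proof.
rewrite mem_filter mem_words; case: (boolP (is_m1_dyck p)) => //= mp.
rewrite (size_dyck (m1_dyck_dyck _ mp)).
by case: eqP => // ->; rewrite eqxx.
Qed.

Lemma uniq_m1_paths n : uniq (m1_paths n).
Proof. by rewrite filter_uniq ?uniq_words. Qed.

Lemma rE n : r n = size (m1_paths n).
Proof. exact: (card_words n (fun p => is_m1_dyck p && (semilength p == n))). Qed.

Lemma bE n : b n = size (m1_ground_paths n).
Proof.
rewrite /m1_ground_paths -filter_predI /b.
rewrite (card_words n (fun p => [&& is_m1_dyck p, semilength p == n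
                                  & no_or_ground_last_valley p])).
by congr size; apply: eq_filter => p /=; rewrite andbA andbC.
Qed.

Lemma semilength_eq0 p : is_dyck p -> (semilength p == 0) = (p == [::]).
Proof. by move=> dp; rewrite -size_eq0 size_dyck // muln_eq0. Qed.

Lemma r0 : r 0 = 1.
Proof.
have m0 : is_m1_dyck [::] by [].
rewrite rE (perm_size (_ : perm_eq _ [:: [::]])) //.
apply: uniq_perm; rewrite ?uniq_m1_paths // => p.
rewrite mem_m1_paths inE; apply/andP/eqP => [[mp]|-> //].
by rewrite (semilength_eq0 _ (m1_dyck_dyck _ mp)) => /eqP.
Qed.

(** Cutting a nonempty path at its first return to the ground: the term [r n]
counts the paths that end there; otherwise [k] is the semi-length of the path
under the arch, and [k < n] says that what follows the arch is nonempty. *)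
Lemma r_rec n : r n.+1 = r n + \sum_(0 <= k < n) b k * r (n - k).
Proof.
pose pairs k := [seq (A, B) | A <- m1_ground_paths k, B <- m1_paths (n - k)].
pose e := [seq arch A [::] | A <- m1_paths n] ++
  [seq arch AB.1 AB.2 | k <- iota 0 n, AB <- pairs k].
have mem_pairs k AB : AB \in pairs k ->
    [/\ is_m1_dyck AB.1, no_or_ground_last_valley AB.1, semilength AB.1 = k,
        is_m1_dyck AB.2 & semilength AB.2 = n - k].
  case/allpairsP=> -[A B] [/=]; rewrite mem_filter !mem_m1_paths.
  by case/and3P=> gA mA /eqP sA /andP[mB /eqP sB] ->.
have dyck := m1_dyck_dyck.
have perm_e : perm_eq (m1_paths n.+1) e.
  apply: uniq_perm; first exact: uniq_m1_paths.
    rewrite cat_uniq; apply/and3P; split.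
    - rewrite map_inj_in_uniq ?uniq_m1_paths // => A A'.
      rewrite !mem_m1_paths => /andP[/dyck dA _] /andP[/dyck dA' _].
      by case/(arch_inj _ _ _ _ dA dA').
    - apply/hasPn=> _ /allpairsPdep[k [AB [+ /mem_pairs[mA _ _ mB sB] ->]]].
      rewrite mem_iota => /andP[_ lt_kn]; apply/mapP=> -[A'].
      rewrite mem_m1_paths => /andP[/dyck dA' _] /(arch_inj _ _ _ _ (dyck _ mA) dA').
      by case=> _ B0; move: sB; rewrite B0 /semilength /=; lia.
    - apply: allpairs_uniq_dep; first exact: iota_uniq.
        move=> k _; apply: allpairs_uniq; rewrite ?filter_uniq ?uniq_words //.
        by case=> [? ?] [? ?] _ _ [-> ->].
      move=> _ _ /allpairsPdep[k [AB [_ ABk ->]]]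
        /allpairsPdep[k' [AB' [_ ABk' ->]]] /= eq_arch.
      have [mA _ sA _ _] := mem_pairs _ _ ABk.
      have [mA' _ sA' _ _] := mem_pairs _ _ ABk'.
      have [eqA eqB] := arch_inj _ _ _ _ (dyck _ mA) (dyck _ mA') eq_arch.
      have eqk : k = k' by rewrite -sA -sA' eqA.
      have eqAB : AB = AB' by case: (AB) (AB') eqA eqB => [? ?] [? ?] /= -> ->.
      by rewrite eqk eqAB.
  move=> p; rewrite mem_m1_paths mem_cat; apply/andP/orP.
    case=> mp /eqP sp; have [|A [B [def_p dA dB]]] := dyck_arch_exists _ (dyck _ mp).
      by apply/eqP=> p0; rewrite p0 in sp.
    move: mp sp; rewrite def_p semilength_arch m1_dyck_arch //.
    have [->|Bn0] := eqVneq B [::].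
      case/andP=> mA _ [sp]; left; apply/map_f; rewrite mem_m1_paths mA -sp.
      by rewrite /semilength addn0 eqxx.
    case/and3P=> mA gA mB [sp]; right; apply/allpairsPdep.
    exists (semilength A), (A, B); split=> //.
      rewrite mem_iota /= add0n -sp -addn1 leq_add2l lt0n.
      by rewrite semilength_eq0.
    apply/allpairsP; exists (A, B); split=> //=.
      by rewrite mem_filter mem_m1_paths gA mA eqxx.
    by rewrite mem_m1_paths mB -sp addKn eqxx.
  case=> [/mapP[A]|/allpairsPdep[k [AB [+ /mem_pairs[mA gA sA mB sB] ->]]]].
    rewrite mem_m1_paths => /andP[mA /eqP sA] ->.
    rewrite m1_dyck_arch ?dyck // mA eqxx semilength_arch sA.
    by rewrite /semilength addn0 eqxx.
  rewrite mem_iota => /andP[_ lt_kn]; rewrite m1_dyck_arch ?dyck // mA gA mB orbT.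
  by rewrite semilength_arch sA sB subnKC // ltnW.
rewrite !rE (perm_size perm_e) size_cat size_map size_allpairs_dep.
congr (_ + _); rewrite sumnE big_map /index_iota subn0.
by apply: eq_bigr => k _; rewrite size_allpairs bE rE.
Qed.

(** * The double sum satisfies the same recurrence *)

(** The iterated convolution of [b], that is, the coefficient of x^l in the
[i]-th power of the generating function of [b]. *)
Fixpoint qconv (i l : nat) : nat :=
  if i is i'.+1 then \sum_(0 <= k < l.+1) b k * qconv i' (l - k) else (l == 0).

(** Truncating the generating function of [b] at a degree [N >= l] does not
change the coefficient of x^l in its powers. *)
Lemma qconv_poly N i l : l <= N ->
  (((\sum_(k < N.+1) (b k)%:R *: 'X^k : {poly int}) ^+ i)`_l = (qconv i l)%:R)%R.
Proof.
rewrite -(poly_def N.+1 (fun k => (b k)%:R%R)).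
elim: i l => [|i IHi] l le_lN; first by rewrite expr0 coef1.
rewrite exprS coefM /= big_mkord natr_sum; apply: eq_bigr => k _.
rewrite coef_poly IHi ?(leq_trans (leq_subr _ _)) //.
by rewrite (leq_trans (ltn_ord k)) ?ltnS // natrM.
Qed.

(** Distributing the power of the truncated generating function gives the sum
over tuples. *)
Lemma qE i l : q i l = qconv i l.
Proof.
apply/eqP; rewrite -(eqr_nat int) -(qconv_poly l) //.
rewrite -[i in (_ ^+ i)%R]card_ord -prodr_const bigA_distr_bigA coef_sum natr_sum.
rewrite big_mkcond; apply/eqP; apply: eq_bigr => t _.
rewrite (_ : (\prod_(j < i) _ =
             (\prod_(j < i) b (t j))%:R *: 'X^(\sum_(j < i) t j))%R).
  by rewrite coefZ coefXn eq_sym; case: eqP => _; rewrite ?mulr1 ?mulr0.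
elim/big_rec3: _ => [|j x y z _ ->]; first by rewrite expr0 scale1r.
by rewrite -scalerAl -scalerAr scalerA natrM exprD.
Qed.

(** The coefficient of x^l in (1 + B)^m, where B generates [b]. *)
Definition c (m l : nat) : nat := \sum_(0 <= i < m.+1) 'C(m, i) * qconv i l.

(** Multiplication by 1 + B, through Pascal's rule. *)
Lemma c_rec m l : c m.+1 l = c m l + \sum_(0 <= k < l.+1) b k * c m (l - k).
Proof.
rewrite /c big_nat_recl //.
under eq_bigr => i _ do rewrite binS mulnDl.
rewrite big_split /= addnA; congr (_ + _).
  rewrite [RHS]big_nat_recl // !bin0; congr (_ + _).
  by rewrite big_nat_recr //= bin_small // mul0n addn0.
under [RHS]eq_bigr => k _ do rewrite big_distrr /=.
rewrite exchange_big /=; apply: eq_bigr => i _; rewrite big_distrr /=.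
by apply: eq_bigr => k _; rewrite mulnCA.
Qed.

(** The double sum, without its empty outer term: the coefficient of x^n in the
sum over m of x^(m+1) (1 + B)^m. *)
Definition T (n : nat) : nat := \sum_(0 <= l < n) c (n - l - 1) l.

(** The term [l = n] of [T n.+1] is [c 0 n], which is [n == 0];
to the others [c_rec] applies, and the double sum is exchanged. *)
Lemma T_rec n : T n.+1 = (n == 0) + T n + \sum_(0 <= k < n) b k * T (n - k).
Proof.
rewrite /T big_nat_recr //= subSnn -addnA addnC; congr (_ + _).
  by rewrite /c big_nat1 bin0 mul1n.
have -> : \sum_(0 <= l < n) c (n.+1 - l - 1) l =
  \sum_(0 <= l < n) (c (n - l - 1) l +
    \sum_(0 <= k < l.+1) b k * c (n - l - 1) (l - k)).
  apply: eq_big_nat => l lt_ln; rewrite -c_rec; congr c; lia.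
rewrite big_split /=; congr (_ + _).
under eq_big_nat => l lt_ln.
  rewrite (big_nat_widen _ _ n) //=; over.
under [RHS]eq_bigr => k _ do rewrite big_distrr /=.
rewrite (exchange_big_dep_nat predT) //=; apply: eq_big_nat => k lt_kn.
rewrite -(big_nat_widenl k 0 n predT) // -{1}[k]add0n big_addn.
apply: eq_big_nat => j _; rewrite addnK; congr (_ * c _ _); lia.
Qed.

(* The inner sum runs over i = 0, ..., n - l - 1, and it is empty for l = n. *)
Theorem theorem3p4 (n : nat) (hn : 1 <= n) :
  r n = \sum_(0 <= l < n.+1) \sum_(0 <= i < n - l) 'C(n - l - 1, i) * q i l.
Proof.
have rT m : r m.+1 = T m.+1.
  elim/ltn_ind: m => m IHm; rewrite r_rec T_rec; congr (_ + _).
    by case: m IHm => [_|m IHm]; rewrite ?r0 ?IHm // /T big_nil.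
  apply: eq_big_nat => k /andP[_ lt_km]; congr (_ * _).
  by rewrite -(subnSK lt_km); apply: IHm; lia.
case: n hn => // n _; rewrite rT /T [RHS]big_nat_recr //= subnn big_nil addn0.
apply: eq_big_nat => l /andP[_ lt_ln].
rewrite /c (_ : (_ - _ - 1).+1 = n.+1 - l); last lia.
by apply: eq_bigr => i _; rewrite qE.
Qed.
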